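(* For the classical Stefan problem, i.e. for the case $\alpha=0$, problem $(\mathrm{P}_4)$ has a unique solution, given by $$T_4^{(0)}(x,t)=\theta_\infty\left[A_4^{(0)}\left(1-\frac{x}{s_4^{(0)}(t)}\right)+B_4^{(0)}\left(1-\frac{x}{s_4^{(0)}(t)}\right)^2\right],\qquad s_4^{(0)}(t)=2a\nu_4^{(0)}\sqrt{t},$$ where the constants $A_4^{(0)}$ and $B_4^{(0)}$ are defined as functions of $\nu_4^{(0)}$ by $$A_4^{(0)}=\frac{2(\nu_4^{(0)})^2}{\mathrm{Ste}},\qquad B_4^{(0)}=1-\frac{2(\nu_4^{(0)})^2}{\mathrm{Ste}},$$ and $\nu_4^{(0)}>0$ is the value where the function $$E^{(0)}(\xi)=\frac{t^{-2}\theta_\infty^2}{60\,\mathrm{Ste}^2}\,\frac{p^{(0)}(\xi)}{\xi^4},\qquad \xi>0,$$ attains its minimum, for every $t>0$, with $$p^{(0)}(\xi)=8\xi^8+2(10+\mathrm{Ste})\xi^6+2(30+5\,\mathrm{Ste}+\mathrm{Ste}^2)\xi^4-10\,\mathrm{Ste}(6+\mathrm{Ste})\xi^2+15\,\mathrm{Ste}^2.$$ In addition, $\nu_4^{(0)}$ can be obtained as the unique positive root of the real polynomial $$r(\xi)=32\xi^8+4(10+\mathrm{Ste})\xi^6+20\,\mathrm{Ste}(6+\mathrm{Ste})\xi^2-60\,\mathrm{Ste}^2.$$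
   Context: Here $\alpha=0$. Fix real parameters $k,\rho,c,\gamma,\theta_\infty>0$; put $a=\sqrt{k/(\rho c)}$ and define the Stefan number $\mathrm{Ste}=\dfrac{k\theta_\infty}{\gamma a^{2}}$. A candidate pair $(T,s)$ consists of a continuous function $s:[0,\infty)\to[0,\infty)$, positive and continuously differentiable on $(0,\infty)$, and a function with quadratic profile in space $$T(x,t)=\theta_\infty\left[A\left(1-\frac{x}{s(t)}\right)+B\left(1-\frac{x}{s(t)}\right)^2\right],\quad 0\le x\le s(t),\ t>0,$$ with real constants $A,B$. The least-squares error of a candidate pair at time $t>0$ is $$E=\theta_\infty^2\tfrac{\dot s(t)^2}{s(t)^2}\left(\tfrac{A^2}{3}+\tfrac{AB}{3}+\tfrac{2B^2}{15}\right)+4a^4\theta_\infty^2\tfrac{B^2}{s(t)^4}-4a^2\theta_\infty^2\tfrac{\dot s(t)}{s(t)^3}B\left(\tfrac A2+\tfrac B3\right),$$ which equals $\dfrac{1}{s(t)}\displaystyle\int_0^{s(t)}\left(\frac{\partial T}{\partial t}-a^2\frac{\partial^2T}{\partial x^2}\right)^2dx$. Problem $(\mathrm{P}_4)$ (with $\alpha=0$): among all candidate pairs satisfying, for all $t>0$, (i) $T(0,t)=\theta_\infty$, (ii) $T(s(t),t)=0$, (iii) $k\frac{\partial T}{\partial x}(s(t),t)=-\gamma\dot s(t)$, and (iv) $s(0)=0$, find a pair that minimizes the error $E$ for every $t>0$. The superscript $(0)$ refers to $\alpha=0$. *)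

(* Defs.v *)
From Stdlib Require Import Reals.
From Coquelicot Require Import Coquelicot.
Open Scope R_scope.

Definition diffusion_coef (k rho c : R) : R := sqrt (k / (rho * c)).

Definition Stefan_number (k gamma theta a : R) : R := k * theta / (gamma * a ^ 2).

Definition is_left_derive (f : R -> R) (x d : R) : Prop :=
  filterlim (fun y => (f y - f x) / (y - x)) (at_left x) (locally d).

Definition quadratic_profile (theta A B : R) (s : R -> R) (x t : R) : R :=
  theta * (A * (1 - x / s t) + B * (1 - x / s t) ^ 2).

Definition free_boundary (s : R -> R) : Prop :=
  (forall t, 0 <= t -> 0 <= s t) /\
  continuous_on (fun t => 0 <= t) s /\
  (forall t, 0 < t -> 0 < s t /\ ex_derive s t /\ continuous (Derive s) t).

(* [T] and [s] are total functions, but [T] is constrained (and meaningful) only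
   for [0 <= x <= s t], [0 < t], and [s] only on [0, +oo). *)
Definition candidate (theta A B : R) (T : R -> R -> R) (s : R -> R) : Prop :=
  free_boundary s /\
  (forall x t, 0 < t -> 0 <= x <= s t -> T x t = quadratic_profile theta A B s x t).

(* The space derivative in the Stefan condition is one-sided, since the domain
   of [T] ends at [x = s t]. *)
Definition admissible (k gamma theta A B : R) (T : R -> R -> R) (s : R -> R) : Prop :=
  candidate theta A B T s /\
  (forall t, 0 < t -> T 0 t = theta) /\
  (forall t, 0 < t -> T (s t) t = 0) /\
  (forall t, 0 < t -> exists dT, is_left_derive (fun x => T x t) (s t) dT /\
                                 k * dT = - gamma * Derive s t) /\
  s 0 = 0.

(* Value of [/ s t * \int_0^(s t) (dT/dt - a^2 d^2T/dx^2)^2 dx] for the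
   quadratic profile with coefficients [A], [B]. *)
Definition least_squares_error (theta a A B : R) (s : R -> R) (t : R) : R :=
  theta ^ 2 * (Derive s t ^ 2 / s t ^ 2)
    * (A ^ 2 / 3 + A * B / 3 + 2 * B ^ 2 / 15)
  + 4 * a ^ 4 * theta ^ 2 * (B ^ 2 / s t ^ 4)
  - 4 * a ^ 2 * theta ^ 2 * (Derive s t / s t ^ 3) * B * (A / 2 + B / 3).

(* [A] and [B] are determined by [T] and [s], because [0 < s t] for [0 < t]. *)
Definition solves_P4 (k gamma theta a : R) (T : R -> R -> R) (s : R -> R) : Prop :=
  exists A B,
    admissible k gamma theta A B T s /\
    forall t, 0 < t ->
    forall A' B' T' s', admissible k gamma theta A' B' T' s' ->
      least_squares_error theta a A B s t <= least_squares_error theta a A' B' s' t.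

Definition s4 (a nu t : R) : R := 2 * a * nu * sqrt t.
Definition A4 (Ste nu : R) : R := 2 * nu ^ 2 / Ste.
Definition B4 (Ste nu : R) : R := 1 - 2 * nu ^ 2 / Ste.
Definition T4 (theta a Ste nu : R) : R -> R -> R :=
  quadratic_profile theta (A4 Ste nu) (B4 Ste nu) (s4 a nu).

Definition p0 (Ste xi : R) : R :=
  8 * xi ^ 8 + 2 * (10 + Ste) * xi ^ 6 + 2 * (30 + 5 * Ste + Ste ^ 2) * xi ^ 4
  - 10 * Ste * (6 + Ste) * xi ^ 2 + 15 * Ste ^ 2.

Definition E0 (theta Ste t xi : R) : R :=
  / t ^ 2 * theta ^ 2 / (60 * Ste ^ 2) * (p0 Ste xi / xi ^ 4).

Definition r0 (Ste xi : R) : R :=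
  32 * xi ^ 8 + 4 * (10 + Ste) * xi ^ 6 + 20 * Ste * (6 + Ste) * xi ^ 2 - 60 * Ste ^ 2.

(* Main.v *)
(** The boundary conditions leave one free parameter: [T(0,t) = theta] gives
    [A + B = 1], and the Stefan condition reads [(s^2)' = 2 Ste a^2 A], so that
    [s = 2 a xi sqrt t] with [A = 2 xi^2 / Ste]. The error of such a pair is
    [E0 xi], a function of [u = xi^2]. With [u0] the square of the positive root
    of [r0] (unique because [r0] is increasing), the difference of the values of
    [p0 / u^2] at [u] and [u0] is [(u - u0)^2] times a positive quantity, so the
    minimizer is unique. *)
Require Import Defs.
From Stdlib Require Import Reals Lra Psatz.
From Coquelicot Require Import Coquelicot.
Open Scope R_scope.

(** * The positive root of [r0] and the minimizer of [E0] *)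

Lemma r0_increasing (S x y : R) : 0 < S -> 0 <= x < y -> r0 S x < r0 S y.
Proof.
intros hS [hx hxy].
assert (h2 : x ^ 2 < y ^ 2) by nra.
assert (h6 : x ^ 6 <= y ^ 6) by (apply pow_incr; lra).
assert (h8 : x ^ 8 <= y ^ 8) by (apply pow_incr; lra).
unfold r0.
assert (0 < S * (6 + S)) by nra.
nra.
Qed.

Lemma r0_root_exists (S : R) : 0 < S -> exists nu, 0 < nu /\ r0 S nu = 0.
Proof.
intros hS.
assert (hcont : continuity (r0 S)) by (unfold r0; reg).
assert (h0 : r0 S 0 < 0) by (unfold r0; nra).
(* The endpoint 2 serves every [S]: the quadratic term there contributes [80 * S ^ 2], which
   outweighs [- 60 * S ^ 2]. *)
assert (h2 : 0 < r0 S 2) by (unfold r0; nra).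
destruct (IVT (r0 S) 0 2 hcont ltac:(lra) h0 h2) as [nu [hnu hr]].
exists nu; split; [|exact hr].
destruct (Req_dec nu 0) as [e|]; [rewrite e in hr|]; lra.
Qed.

Lemma r0_root_unique (S x y : R) :
  0 < S -> 0 < x -> 0 < y -> r0 S x = 0 -> r0 S y = 0 -> x = y.
Proof.
intros hS hx hy rx ry.
destruct (Rtotal_order x y) as [h|[h|h]]; [|exact h|].
- pose proof (r0_increasing S x y hS ltac:(lra)); lra.
- pose proof (r0_increasing S y x hS ltac:(lra)); lra.
Qed.

(* Twice the factor multiplying [(u - u0)^2 / (u u0)^2] in the difference of the
   values of [p0 / u^2] at [u = xi^2] and [u0 = nu^2]. *)
Definition gap_factor (S u u0 : R) : R :=
  16 * (u + u0) ^ 2 * u0 ^ 2 + (20 + 2 * S) * u0 ^ 2 * (2 * u + u0)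
  + 10 * S * (6 + S) * u0.

(** In the variable [u = xi ^ 2] the derivative of [p0 / u ^ 2] is [r0 / (2 * u ^ 3)], so at a root
    of [r0] the difference has a double zero. *)
Lemma p0_gap (S nu xi : R) : 0 < nu -> 0 < xi -> r0 S nu = 0 ->
  p0 S xi / xi ^ 4 - p0 S nu / nu ^ 4
  = (xi ^ 2 - nu ^ 2) ^ 2 * gap_factor S (xi ^ 2) (nu ^ 2) / (2 * xi ^ 4 * nu ^ 4).
Proof.
intros hnu hxi hr.
(* The first-order remainder is a multiple of [r0 S nu], which the root condition removes. *)
assert (h : p0 S xi / xi ^ 4 - p0 S nu / nu ^ 4
  - (xi ^ 2 - nu ^ 2) ^ 2 * gap_factor S (xi ^ 2) (nu ^ 2) / (2 * xi ^ 4 * nu ^ 4)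
  = (xi ^ 2 - nu ^ 2) * (xi ^ 2 + nu ^ 2) / (4 * xi ^ 4 * nu ^ 4) * r0 S nu).
{ unfold p0, gap_factor, r0. field. lra. }
rewrite hr in h. lra.
Qed.

Lemma gap_factor_pos (S u u0 : R) : 0 < S -> 0 < u -> 0 < u0 -> 0 < gap_factor S u u0.
Proof.
intros hS hu hu0. unfold gap_factor.
assert (0 < S * (6 + S) * u0) by (repeat apply Rmult_lt_0_compat; lra).
assert (0 < (20 + 2 * S) * u0 ^ 2 * (2 * u + u0))
  by (repeat apply Rmult_lt_0_compat; try apply pow_lt; lra).
assert (0 < (u + u0) ^ 2 * u0 ^ 2) by (apply Rmult_lt_0_compat; apply pow_lt; lra).
lra.
Qed.

Lemma p0_quotient_lt (S nu xi : R) : 0 < S -> 0 < nu -> 0 < xi -> r0 S nu = 0 ->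
  xi <> nu -> p0 S nu / nu ^ 4 < p0 S xi / xi ^ 4.
Proof.
intros hS hnu hxi hr hne.
apply Rlt_0_minus. rewrite p0_gap by assumption.
assert (hd : xi ^ 2 - nu ^ 2 <> 0).
{ replace (xi ^ 2 - nu ^ 2) with ((xi - nu) * (xi + nu)) by ring.
  apply Rmult_integral_contrapositive; lra. }
apply Rdiv_lt_0_compat.
- apply Rmult_lt_0_compat; [apply pow2_gt_0; exact hd|].
  apply gap_factor_pos; [exact hS|apply pow_lt; lra|apply pow_lt; lra].
- repeat apply Rmult_lt_0_compat; try apply pow_lt; lra.
Qed.

(** Time and [theta] enter [E0] only through a positive prefactor, so one [nu] serves all [t]. *)
Lemma E0_lt (theta S t nu xi : R) : 0 < theta -> 0 < S -> 0 < t -> 0 < nu -> 0 < xi ->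
  r0 S nu = 0 -> xi <> nu -> E0 theta S t nu < E0 theta S t xi.
Proof.
intros hth hS ht hnu hxi hr hne. unfold E0.
apply Rmult_lt_compat_l; [|apply p0_quotient_lt; assumption].
apply Rdiv_lt_0_compat.
- apply Rmult_lt_0_compat; [apply Rinv_0_lt_compat|]; apply pow_lt; lra.
- apply Rmult_lt_0_compat; [|apply pow_lt]; lra.
Qed.

Lemma E0_le (theta S t nu xi : R) : 0 < theta -> 0 < S -> 0 < t -> 0 < nu -> 0 < xi ->
  r0 S nu = 0 -> E0 theta S t nu <= E0 theta S t xi.
Proof.
intros hth hS ht hnu hxi hr.
destruct (Req_dec xi nu) as [e|hne]; [rewrite e; lra|].
left; apply E0_lt; assumption.
Qed.

(** * The Stefan condition as a differential equation for [s] *)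

Lemma profile_left_derive (theta A B : R) (s : R -> R) (t : R) (f : R -> R) :
  0 < s t ->
  (forall x, 0 <= x <= s t -> f x = quadratic_profile theta A B s x t) ->
  is_left_derive f (s t) (- theta * A / s t).
Proof.
intros hS hf. unfold is_left_derive.
apply filterlim_ext_loc with
  (f := fun y => theta * (- A / s t + B * (y - s t) / s t ^ 2)).
(* Radius [s t] keeps [y] between 0 and [s t], where [f] is the profile and its difference quotient
   is affine in [y]. *)
- exists (mkposreal _ hS). intros y hy hlt.
  assert (0 < y) by (change (Rabs (y - s t) < s t) in hy; apply Rabs_def2 in hy; lra).
  rewrite (hf y), (hf (s t)) by lra. unfold quadratic_profile. field. lra.
- replace (- theta * A / s t) with
    (theta * (- A / s t + B * (s t - s t) / s t ^ 2)) by (field; lra).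
  eapply filterlim_filter_le_1; [apply filter_le_within|].
  apply (ex_derive_continuous (K := R_AbsRing) (V := R_NormedModule)
    (fun y => theta * (- A / s t + B * (y - s t) / s t ^ 2))).
  auto_derive. exact I.
Qed.

Lemma left_derive_unique (f : R -> R) (x d d' : R) :
  is_left_derive f x d -> is_left_derive f x d' -> d = d'.
Proof. intros h h'. exact (filterlim_locally_unique _ _ _ h h'). Qed.

(** The derivative of [s t ^ 2 - 2 * C * t] vanishes for [0 < t], so this quantity is constant
    there; its right-hand limit at 0 shows that the constant is 0. *)
Lemma half_square_linear (s : R -> R) (C : R) :
  continuous_on (fun t => 0 <= t) s -> s 0 = 0 ->
  (forall t, 0 < t -> ex_derive s t) ->
  (forall t, 0 < t -> s t * Derive s t = C) ->
  forall t, 0 < t -> s t ^ 2 = 2 * C * t.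
Proof.
intros hc h0 hd hC.
set (h := fun t => s t ^ 2 - 2 * C * t).
assert (hder : forall t, 0 < t -> is_derive h t 0).
{ intros t ht. unfold h. auto_derive; [exact (hd t ht)|].
  replace (fun x : R => s x) with s by reflexivity.
  pose proof (hC t ht). lra. }
assert (hconst : forall u v, 0 < u -> 0 < v -> h u = h v).
{ intros u v hu hv.
  destruct (MVT_gen h u v (fun _ => 0)) as [w [_ hw]].
  - intros x [hx _]. apply hder. apply Rlt_trans with (2 := hx).
    apply Rmin_glb_lt; assumption.
  - intros x [hx _]. apply continuity_pt_filterlim.
    apply (ex_derive_continuous (K := R_AbsRing) (V := R_NormedModule)).
    exists 0. apply hder. apply Rlt_le_trans with (2 := hx).
    apply Rmin_glb_lt; assumption.
  - lra. }
intros t ht.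
assert (hs : filterlim s (at_right 0) (locally 0)).
{ assert (hle : filter_le (at_right 0) (within (fun t => 0 <= t) (locally 0))).
  { intros P [d hd']. exists d. intros x hx hlt. apply hd'; [exact hx|lra]. }
  pose proof (filterlim_filter_le_1 s hle (hc 0 (Rle_refl 0))) as hl.
  rewrite h0 in hl. exact hl. }
assert (hlim : filterlim h (at_right 0) (locally 0)).
(* The limit takes the shape that the product and sum rules produce; the 0 in [at_right 0] stays. *)
{ replace 0 with (0 * 0 + - (2 * C * 0)) at 2 by ring.
  apply filterlim_ext with (f := fun x => s x * s x + - (2 * C * x)).
  { intros x. unfold h. ring. }
  eapply (filterlim_comp_2 (fun x => s x * s x) (fun x => - (2 * C * x)) Rplus).
  - eapply (filterlim_comp_2 s s Rmult); [exact hs|exact hs|].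
    apply (filterlim_mult (K := R_AbsRing) 0 0).
  - eapply filterlim_filter_le_1; [apply filter_le_within|].
    apply (ex_derive_continuous (K := R_AbsRing) (V := R_NormedModule)
      (fun x => - (2 * C * x))).
    auto_derive. exact I.
  - apply (filterlim_plus (V := R_NormedModule) (0 * 0) (- (2 * C * 0))). }
(* The constant value [h t] is also a limit at 0, so uniqueness of limits forces [h t = 0]. *)
assert (hlim' : filterlim h (at_right 0) (locally (h t))).
{ apply filterlim_ext_loc with (f := fun _ => h t).
  - exists (mkposreal 1 Rlt_0_1). intros x _ hx. apply hconst; assumption.
  - apply filterlim_const. }
pose proof (filterlim_locally_unique _ _ _ hlim hlim') as e.
unfold h in e. lra.
Qed.

(** * The one-parameter family of admissible pairs and its error *)

Lemma stefan_product (k gamma theta a : R) : 0 < gamma -> 0 < a ->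
  k * theta / gamma = Stefan_number k gamma theta a * a ^ 2.
Proof. intros. unfold Stefan_number. field. lra. Qed.

Lemma is_derive_s4 (a nu t : R) : 0 < t -> is_derive (s4 a nu) t (a * nu / sqrt t).
Proof.
intros ht. unfold s4. pose proof (sqrt_lt_R0 t ht).
auto_derive; [exact ht|field; lra].
Qed.

Lemma s4_pos (a nu t : R) : 0 < a -> 0 < nu -> 0 < t -> 0 < s4 a nu t.
Proof.
intros ha hnu ht. unfold s4. pose proof (sqrt_lt_R0 t ht).
repeat apply Rmult_lt_0_compat; lra.
Qed.

Lemma s4_free_boundary (a nu : R) : 0 < a -> 0 < nu -> free_boundary (s4 a nu).
Proof.
intros ha hnu. split; [|split].
- intros t ht. unfold s4. pose proof (sqrt_pos t).
  repeat apply Rmult_le_pos; lra.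
(* [sqrt] is 0 on negative arguments, hence continuous on the whole line, in particular at the
   endpoint 0. *)
- apply continuous_on_forall. intros t _. unfold s4.
  apply (continuous_scal_r (K := R_AbsRing) (V := R_NormedModule) (2 * a * nu) sqrt).
  apply continuous_sqrt.
- intros t ht. split; [apply s4_pos; assumption|split].
  + eexists; apply is_derive_s4; exact ht.
  + apply continuous_ext_loc with (g := fun u => a * nu / sqrt u).
    * exists (mkposreal t ht). intros u hu. symmetry.
      apply is_derive_unique, is_derive_s4.
      change (Rabs (u - t) < t) in hu. apply Rabs_def2 in hu. lra.
    * apply (ex_derive_continuous (K := R_AbsRing) (V := R_NormedModule)
        (fun u => a * nu / sqrt u)).
      pose proof (sqrt_lt_R0 t ht). auto_derive. repeat split; lra.
Qed.

(** [A4 + B4 = 1] gives the condition at [x = 0], and the Stefan condition holds because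
    [s s' = 2 a^2 nu^2 = Ste a^2 A4]. *)
Lemma T4_admissible (k gamma theta a nu : R) :
  0 < k -> 0 < gamma -> 0 < theta -> 0 < a -> 0 < nu ->
  let S := Stefan_number k gamma theta a in
  admissible k gamma theta (A4 S nu) (B4 S nu) (T4 theta a S nu) (s4 a nu).
Proof.
intros hk hg hth ha hnu S.
assert (hS : 0 < S) by (unfold S, Stefan_number; apply Rdiv_lt_0_compat;
  apply Rmult_lt_0_compat; try apply pow_lt; lra).
pose proof (s4_pos a nu) as hpos.
split; [split; [apply s4_free_boundary; assumption|reflexivity]|].
repeat split.
- intros t ht. specialize (hpos t ha hnu ht).
  unfold T4, quadratic_profile, A4, B4. field. lra.
- intros t ht. specialize (hpos t ha hnu ht).
  unfold T4, quadratic_profile. field. lra.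
- intros t ht. specialize (hpos t ha hnu ht).
  exists (- theta * A4 S nu / s4 a nu t). split.
  + apply profile_left_derive with (B := B4 S nu); [exact hpos|reflexivity].
  + rewrite (is_derive_unique _ _ _ (is_derive_s4 a nu t ht)).
    pose proof (sqrt_lt_R0 t ht).
    unfold A4, s4, S, Stefan_number. field. repeat split; lra.
- unfold s4. rewrite sqrt_0. ring.
Qed.

(** Converse of [T4_admissible]: the competitors are parametrized by [xi], so minimizing over pairs
    becomes minimizing a function of one real variable. *)
Lemma admissible_similarity (k gamma theta a A B : R) (T : R -> R -> R) (s : R -> R) :
  0 < k -> 0 < gamma -> 0 < theta -> 0 < a ->
  let S := Stefan_number k gamma theta a in
  admissible k gamma theta A B T s ->
  exists xi, 0 < xi /\ A = A4 S xi /\ B = B4 S xi /\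
    (forall t, 0 <= t -> s t = s4 a xi t).
Proof.
intros hk hg hth ha S [[[_ [hcont hreg]] hprof] [hT0 [_ [hstefan hs0]]]].
assert (hS : 0 < S) by (unfold S, Stefan_number; apply Rdiv_lt_0_compat;
  apply Rmult_lt_0_compat; try apply pow_lt; lra).
assert (hAB : A + B = 1).
{ destruct (hreg 1 Rlt_0_1) as [hp _]. pose proof (hT0 1 Rlt_0_1) as e.
  rewrite hprof in e by lra. unfold quadratic_profile in e.
  replace (0 / s 1) with 0 in e by (field; lra).
  apply Rmult_eq_reg_l with theta; lra. }
assert (hsq : forall t, 0 < t -> s t ^ 2 = 2 * (S * a ^ 2 * A) * t).
{ apply half_square_linear; [exact hcont|exact hs0|apply hreg|].
  intros t ht. destruct (hreg t ht) as [hp _].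
  destruct (hstefan t ht) as [d [hd hk']].
  (* The Stefan condition only provides some left derivative; uniqueness identifies it with that of
     the profile. *)
  rewrite (left_derive_unique _ _ _ _ hd
    (profile_left_derive theta A B s t _ hp (fun x => hprof x t ht))) in hk'.
  unfold S. rewrite <- stefan_product by assumption.
  replace (Derive s t) with (- (k * (- theta * A / s t)) / gamma)
    by (rewrite hk'; field; lra).
  field. lra. }
(* The sign of [A] is read off from [0 < s 1 ^ 2] in the law just found. *)
assert (hA : 0 < A).
{ destruct (hreg 1 Rlt_0_1) as [hp _]. pose proof (hsq 1 Rlt_0_1).
  assert (0 < S * a ^ 2) by (apply Rmult_lt_0_compat; [|apply pow_lt]; lra).
  assert (0 < s 1 ^ 2) by (apply pow_lt; exact hp). nra. }
assert (hrad : 0 < S * A / 2) by (apply Rdiv_lt_0_compat; nra).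
(* The positive solution of [A = 2 * xi ^ 2 / S]. *)
set (xi := sqrt (S * A / 2)).
assert (hxi : 0 < xi) by (apply sqrt_lt_R0; exact hrad).
assert (hxi2 : xi ^ 2 = S * A / 2) by (apply pow2_sqrt; lra).
exists xi. repeat split.
- exact hxi.
- unfold A4. rewrite hxi2. field. lra.
- unfold B4. rewrite hxi2. replace B with (1 - A) by lra. field. lra.
- intros t [ht| <-]; [|unfold s4; rewrite hs0, sqrt_0; ring].
  destruct (hreg t ht) as [hp _]. pose proof (s4_pos a xi t ha hxi ht).
  apply Rsqr_inj; [lra|lra|]. rewrite !Rsqr_pow2, (hsq t ht). unfold s4.
  rewrite !Rpow_mult_distr, hxi2, pow2_sqrt by lra. field.
Qed.

(** Along [s4] the factors of [a] cancel and all three terms scale as [/ t ^ 2]. *)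
Lemma error_s4 (theta a S xi t : R) (s : R -> R) :
  0 < a -> 0 < S -> 0 < xi -> 0 < t ->
  (forall u, 0 <= u -> s u = s4 a xi u) ->
  least_squares_error theta a (A4 S xi) (B4 S xi) s t = E0 theta S t xi.
Proof.
intros ha hS hxi ht hs.
assert (hd : Derive s t = a * xi / sqrt t).
{ apply is_derive_unique, is_derive_ext_loc with (f := s4 a xi).
  - exists (mkposreal t ht). intros u hu. symmetry. apply hs.
    change (Rabs (u - t) < t) in hu. apply Rabs_def2 in hu. lra.
  - apply is_derive_s4; exact ht. }
unfold least_squares_error. rewrite hd, hs by lra. unfold E0, s4, A4, B4, p0.
pose proof (sqrt_lt_R0 t ht) as hq.
(* Writing [t] as [q ^ 2] makes the identity rational in [q]. *)
assert (ht2 : t = sqrt t ^ 2) by (rewrite pow2_sqrt; lra).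
clear hd hs. set (q := sqrt t) in *. clearbody q. subst t.
field. repeat split; lra.
Qed.

Theorem corollary5p1 (k rho c gamma theta : R)
  (hk : 0 < k) (hrho : 0 < rho) (hc : 0 < c) (hgamma : 0 < gamma) (htheta : 0 < theta) :
  let a := diffusion_coef k rho c in
  let Ste := Stefan_number k gamma theta a in
  exists nu : R,
    0 < nu /\
    (forall t, 0 < t ->
       unique (fun xi => 0 < xi /\
                 forall eta, 0 < eta -> E0 theta Ste t xi <= E0 theta Ste t eta) nu) /\
    solves_P4 k gamma theta a (T4 theta a Ste nu) (s4 a nu) /\
    (forall (T : R -> R -> R) (s : R -> R), solves_P4 k gamma theta a T s ->
       (forall t, 0 <= t -> s t = s4 a nu t) /\
       (forall x t, 0 < t -> 0 <= x <= s t -> T x t = T4 theta a Ste nu x t)) /\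
    unique (fun xi => 0 < xi /\ r0 Ste xi = 0) nu.
Proof.
intros a Ste.
assert (ha : 0 < a).
{ apply sqrt_lt_R0, Rdiv_lt_0_compat; [|apply Rmult_lt_0_compat]; assumption. }
assert (hS : 0 < Ste) by (unfold Ste, Stefan_number; apply Rdiv_lt_0_compat;
  apply Rmult_lt_0_compat; try apply pow_lt; lra).
destruct (r0_root_exists Ste hS) as [nu [hnu hr]].
(* Strict minimality at [nu], in the form that yields uniqueness both of the minimizer of [E0] and
   of the solution. *)
assert (huniq : forall t xi, 0 < t -> 0 < xi ->
  E0 theta Ste t xi <= E0 theta Ste t nu -> xi = nu).
{ intros t xi ht hxi hle. destruct (Req_dec xi nu) as [e|hne]; [exact e|].
  pose proof (E0_lt theta Ste t nu xi htheta hS ht hnu hxi hr hne). lra. }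
pose proof (T4_admissible k gamma theta a nu hk hgamma htheta ha hnu) as hadm.
assert (hsol : forall T s, solves_P4 k gamma theta a T s ->
  (forall t, 0 <= t -> s t = s4 a nu t) /\
  (forall x t, 0 < t -> 0 <= x <= s t -> T x t = T4 theta a Ste nu x t)).
{ intros T s [A [B [hTs hmin]]].
  pose proof hTs as [[_ hprof] _].
  destruct (admissible_similarity k gamma theta a A B T s hk hgamma htheta ha hTs)
    as [xi [hxi [hA [hB hs]]]].
  fold Ste in hA, hB.
  assert (e : xi = nu).
  (* Comparison with the admissible pair at [nu] at the single time 1 already fixes [xi]. *)
  { apply (huniq 1); [lra|assumption|].
    pose proof (hmin 1 Rlt_0_1 _ _ _ _ hadm) as hle. rewrite hA, hB in hle.
    rewrite (error_s4 theta a _ xi 1), (error_s4 theta a _ nu 1) in hle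
      by (assumption || reflexivity || lra).
    exact hle. }
  subst xi. split; [exact hs|].
  intros x t ht hx. rewrite hprof by assumption.
  unfold T4, quadratic_profile. rewrite hA, hB, hs by lra. reflexivity. }
exists nu. split; [exact hnu|split; [|split; [|split; [exact hsol|]]]].
- intros t ht. split; [split; [exact hnu|]|].
  { intros eta heta. apply E0_le; assumption. }
  intros xi [hxi hmin]. symmetry. apply (huniq t); [assumption..|].
  apply hmin; exact hnu.
- exists (A4 Ste nu), (B4 Ste nu). split; [exact hadm|].
  intros t ht A B T s hTs.
  (* Every competitor is a similarity pair, so its error is [E0] at its own parameter. *)
  destruct (admissible_similarity k gamma theta a A B T s hk hgamma htheta ha hTs)
    as [xi [hxi [-> [-> hs]]]].
  rewrite (error_s4 theta a _ nu t), (error_s4 theta a _ xi t) by (assumption || reflexivity).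
  apply E0_le; assumption.
- split; [split; assumption|].
  intros xi [hxi hrxi]. apply (r0_root_unique Ste); assumption.
Qed.
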